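(* $n(14,7) \leq 4716$; that is, there exists a $14$-regular graph of girth exactly $7$ with at most $4716$ vertices.
   Context: Graphs are finite and simple. For integers $k\ge 2$, $g\ge 3$, a $(k,g)$-graph is a $k$-regular graph with girth $g$ (the length of a shortest cycle is exactly $g$). $n(k,g)$ denotes the smallest possible number of vertices of a $(k,g)$-graph. *)

(* Defs.v *)
From mathcomp Require Import all_boot.

Set Implicit Arguments.
Unset Strict Implicit.
Unset Printing Implicit Defensive.

Record sgraph := SGraph {
  vertex :> finType;
  adj : rel vertex;
  adj_sym : symmetric adj;
  adj_irrefl : irreflexive adj
}.

Definition regular (k : nat) (G : sgraph) : Prop :=
  forall x : G, #|[set y : G | adj x y]| = k.

(* [ucycle] also accepts sequences of size at most 2: the empty one and, in a
   simple graph, those that go back and forth along an edge; these are not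
   graph cycles. *)
Definition graph_cycle (G : sgraph) (c : seq G) : Prop :=
  ucycle (@adj G) c /\ 3 <= size c.

Definition has_girth (g : nat) (G : sgraph) : Prop :=
  (exists c : seq G, graph_cycle c /\ size c = g) /\
  (forall c : seq G, graph_cycle c -> g <= size c).

(* Used for k >= 2 and g >= 3. *)
Definition kg_graph (k g : nat) (G : sgraph) : Prop :=
  regular k G /\ has_girth g G.

(* [is_min_order k g n] reads n = n(k,g).  The minimum is given as a relation,
   since as a total function it would need a default value for pairs (k, g)
   without any (k,g)-graph. *)
Definition is_min_order (k g n : nat) : Prop :=
  (exists G : sgraph, kg_graph k g G /\ #|G| = n) /\
  (forall G : sgraph, kg_graph k g G -> n <= #|G|).

(* Main.v *)
Require Import Defs.
From mathcomp Require Import all_boot all_algebra ring.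
From Stdlib Require Import Classical_Prop.

(* The incidence graph of the symplectic generalized quadrangle W(3,13) is
   14-regular of girth 8 and has 2 * 2380 vertices.  Delete 52 pairwise disjoint
   lines; each of the 52 * 14 points on them loses one neighbour, which is
   restored by a perfect matching on the 14 points of each deleted line.  Two
   points of a deleted line are at distance at least 6 in what is left, so the
   only possible new cycles of length at most 6 use two matching edges {p, p'}
   and {q, q'} with p, q collinear and p', q' collinear.  The deleted lines are
   4 orbits of a group of order 13, and 4 matchings, constant on the orbits,
   can be chosen without such a configuration, so that 4760 - 52 = 4708
   vertices remain. *)

Set Implicit Arguments.
Unset Strict Implicit.
Unset Printing Implicit Defensive.

Import GRing.Theory.

(** * Exchanging disjoint lines for perfect matchings *)

Section RewiredGeometry.

Variables (P L : finType) (I : P -> L -> bool) (D : {set L}) (mate : P -> P).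

Hypothesis lin : forall p q l m, I p l -> I q l -> I p m -> I q m ->
  p = q \/ l = m.
Hypothesis tri : forall p q r l m n, I p l -> I q l -> I q m -> I r m ->
  I r n -> I p n -> l != m -> m != n -> n != l -> p = q.
Hypothesis mateK : involutive mate.
(** Through the coercion from bool this covers two facts: the deleted lines are pairwise disjoint,
    and [mate] moves exactly the points on them. *)
Hypothesis card_deleted : forall p, #|[set l in D | I p l]| = (mate p != p).
Hypothesis mate_line : forall p l, l \in D -> I p l -> I (mate p) l.
Hypothesis quad : forall p q l m, mate p != p -> mate q != q ->
  l \notin D -> m \notin D -> I p l -> I q l -> I (mate p) m -> I (mate q) m ->
  p = q.

Definition rewired_vertex : finType := (P + {l | l \notin D})%type.

Definition rewired_adj (x y : rewired_vertex) : bool :=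
  match x, y with
  | inl p, inl q => (mate p == q) && (p != q)
  | inl p, inr l => I p (val l)
  | inr l, inl p => I p (val l)
  | inr _, inr _ => false
  end.

Lemma rewired_adj_sym : symmetric rewired_adj.
Proof.
case=> [p|l] [q|m] //=; rewrite (eq_sym q p); congr (_ && _).
by apply/eqP/eqP => <-; rewrite mateK.
Qed.

Lemma rewired_adj_irrefl : irreflexive rewired_adj.
Proof. by case=> [p|l] //=; rewrite eqxx andbF. Qed.

Definition rewired_graph : sgraph := SGraph rewired_adj_sym rewired_adj_irrefl.

Lemma card_rewired_graph : #|rewired_graph| = #|P| + (#|L| - #|D|).
Proof.
rewrite card_sum card_sig; congr (_ + _).
rewrite -{2}(setCK D) -cardsCs.
by apply: eq_card => l; rewrite !inE.
Qed.

Lemma rewired_graph_regular k :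
  (forall p, #|[set l | I p l]| = k) -> (forall l, #|[set p | I p l]| = k) ->
  regular k rewired_graph.
Proof.
move=> degP degL x; rewrite -sum1_card big_sumType /=.
case: x => [p|l] /=; last first.
  rewrite [X in _ + X]big_pred0 ?addn0; last by move=> m; rewrite inE.
  rewrite -(degL (val l)) -sum1_card.
  by apply: eq_bigl => p; rewrite !inE.
(* The line on [p] in [D], if any, is traded for the neighbour [mate p]. *)
rewrite -(degP p) -(cardsID D) addnC [in LHS]addnC.
congr (_ + _).
  rewrite (_ : [set l | I p l] :&: D = [set l in D | I p l]); last first.
    by apply/setP => l; rewrite !inE andbC.
  rewrite card_deleted sum1dep_card.
  case: eqP => [mp|/eqP mp] /=.
    apply/eqP; rewrite cards_eq0; apply/eqP/setP => q; rewrite !inE /= mp.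
    by rewrite andbN.
  apply/eqP/cards1P; exists (mate p); apply/setP => q; rewrite !inE /= eq_sym.
  by case: eqP => // ->; rewrite eq_sym.
rewrite sum1dep_card -(card_imset _ val_inj).
apply: eq_card => l; rewrite !inE; apply/imsetP/andP => [[m] | [lD pl]].
  by rewrite !inE /= => pm ->; split => //; exact: (valP m).
by exists (exist _ l lD); rewrite ?inE.
Qed.

Lemma no_cycle3 p q l : mate p == q -> p != q -> l \notin D ->
  I p l -> I q l -> false.
Proof.
move=> /eqP <- pq lD pl ql.
have : #|[set l in D | I p l]| = 1%N by rewrite card_deleted eq_sym pq.
move=> /eqP/cards1P[d /setP/(_ d)]; rewrite !inE eqxx => /andP[dD pd].
have qd := mate_line dD pd.
by case: (lin pl ql pd qd) => [/eqP|ld]; [rewrite (negPf pq) | rewrite ld dD in lD].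
Qed.

(** Otherwise the deleted line through [p] and [q] would form a triangle with [l] and [m]. *)
Lemma no_cycle5 p q r l m : mate p == q -> p != q ->
  I q l -> I p m -> I r l -> I r m -> l != m -> l \notin D -> m \notin D -> false.
Proof.
move=> /eqP <- pq ql pm rl rm lm lD mD.
have : #|[set l in D | I p l]| = 1%N by rewrite card_deleted eq_sym pq.
move=> /eqP/cards1P[d /setP/(_ d)]; rewrite !inE eqxx => /andP[dD pd].
have qd := mate_line dD pd.
have pq' : p = mate p.
  apply: (tri pd qd ql rl rm pm) => //.
  - by apply: contraNneq lD => <-.
  - by apply: contraNneq mD => ->.
by rewrite -pq' eqxx in pq.
Qed.

Lemma no_cycle6 p q r s l m : mate p == q -> p != q ->
  I q l -> I r l -> q != r -> mate r == s -> r != s -> I s m -> I p m ->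
  l \notin D -> m \notin D -> false.
Proof.
move=> /eqP pq npq ql rl /eqP nqr /eqP rs nrs sm pm lD mD; case: nqr.
have qp : mate q = p by rewrite -pq mateK.
apply: (quad _ _ lD mD ql rl); rewrite ?qp ?rs //.
by rewrite eq_sym.
Qed.

Lemma no_mate_path p q r : mate p == q -> mate q == r -> p != r -> false.
Proof. by move=> /eqP<-; rewrite mateK => ->. Qed.

Lemma no_cycle4 p q l m : p != q -> l != m ->
  I p l -> I q l -> I q m -> I p m -> false.
Proof.
by move=> /eqP pq /eqP lm pl ql qm pm; case: (lin pl ql pm qm).
Qed.

Lemma no_hexagon p q r l m n : p != q -> l != m -> m != n -> n != l ->
  I p l -> I q l -> I q m -> I r m -> I r n -> I p n -> false.
Proof.
move=> /eqP pq lm mn nl pl ql qm rm rn pn; case: pq.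
exact: (tri pl ql qm rm rn pn).
Qed.

(** Each line on a cycle accounts for two edges, and no two matching edges are consecutive. So a
    cycle of length 3 to 6 has (1,1), (2,0), (2,1), (3,0) or (2,2) as its numbers of lines and
    matching edges; each pattern is excluded above. *)
Lemma rewired_graph_girth (c : seq rewired_graph) : graph_cycle c -> 7 <= size c.
Proof.
(* Reversing the cycle supplies each disequality in both orientations for the proof search below. *)
case: c => [|x0 [|x1 [|x2 [|x3 [|x4 [|x5 [|x6 c]]]]]]]
  [] // /andP[+ uc]; have := uc; rewrite -rev_uniq; move: uc => /=.
all: rewrite ?inE ?negb_or ?andbT => neqs neqs' adjs _; exfalso.
all: repeat match goal with H : is_true (_ && _) |- _ => case/andP: H => ? ? end.
all: repeat match goal with x : Finite.sort (vertex rewired_graph) |- _ =>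
  destruct x as [?|[? ?]] end.
all: repeat match goal with
  | H : is_true (rewired_adj _ _) |- _ => progress simpl in H
  | H : is_true (_ && _) |- _ => case/andP: H => ? ? end.
all: try done.
all: simpl in *.
all: repeat match goal with
  | H : is_true (~~ (inl ?a == inl ?b)) |- _ => change (is_true (a != b)) in H
  | H : is_true (~~ (inr (exist _ ?a _) == inr (exist _ ?b _))) |- _ =>
    change (is_true (a != b)) in H
  | H : is_true (~~ (inl _ == inr _)) |- _ => clear H
  | H : is_true (~~ (inr _ == inl _)) |- _ => clear H end.
all: try solve [suff: false by [];
  eauto 5 using no_mate_path, no_cycle3, no_cycle4 with nocore].
all: try solve [suff: false by []; eauto 11 using no_cycle5 with nocore].
all: try solve [suff: false by []; eauto 13 using no_cycle6 with nocore].
all: try solve [suff: false by []; eauto 12 using no_hexagon with nocore].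
Qed.

End RewiredGeometry.

Local Open Scope ring_scope.

(** * The symplectic quadrangle *)

Section SymplecticQuadrangle.

Variable F : finFieldType.

(* Coordinates for W(3,F).  The totally isotropic lines of F^2 x F^2 for the
   form [v1 . w2 - w1 . v2] on (v1, w1), (v2, w2) are:
   - {(v, A v)} for A symmetric: [inl (x, y, z)] with A = ((x, y), (y, z));
   - {(a v0, w) | v0 . w = s a}: [inr (inl (i, s))],
     with v0 the vector of the direction i;
   - {(0, w)}: [inr (inr tt)].
   The direction [Some t] stands for v0 = (1, t) and [None] for (0, 1).  The
   points are [inl (i, w)] = <(v0, w)> and [inr i] = <(0, w)> with v0 . w = 0;
   [symm_act A i] is A v0 and [dot i w] is v0 . w. *)
Definition dir : finType := option F.
Definition symmx : finType := (F * F * F)%type.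
Definition point : finType := (dir * (F * F) + dir)%type.
Definition line : finType := (symmx + (dir * F + unit))%type.

Definition symm_act (A : F * F * F) (i : dir) : F * F :=
  let: (x, y, z) := A in
  if i is Some t then (x + y * t, y + z * t) else (y, z).

Definition dot (i : dir) (w : F * F) : F :=
  if i is Some t then w.1 + t * w.2 else w.2.

Definition incident (p : point) (l : line) : bool :=
  match p, l with
  | inl (i, w), inl A => symm_act A i == w
  | inl (i, w), inr (inl (j, s)) => (i == j) && (dot i w == s)
  | inr i, inr (inl (j, _)) => i == j
  | inr _, inr (inr _) => true
  | _, _ => false
  end.

(* The symmetric matrices that kill the vector of direction i. *)
Definition rank1 (i : dir) (c : F) : F * F * F :=
  if i is Some t then (c * t ^+ 2, - (c * t), c) else (c, 0, 0).

Lemma mul0_eq (a b c : F) : a * (b - c) = 0 -> b = c \/ a = 0.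
Proof.
by move/eqP; rewrite mulf_eq0 subr_eq0 => /orP[] /eqP; [right | left].
Qed.

(** [A - B] kills the vector of direction [i], and the symmetric matrices that do so are the
    multiples of [rank1 i 1]. *)
Lemma symm_act_eq_rank1 A B i :
  symm_act A i = symm_act B i -> exists c, A = B + rank1 i c.
Proof.
case: A B i => [[x y] z] [[x' y'] z'] [t|] /= [e1 e2].
  exists (z - z'); congr (_, _, _) => /=.
  - rewrite -[LHS](addrK (y * t)) e1; rewrite -[y](addrK (z * t)) e2; ring.
  - rewrite -[LHS](addrK (z * t)) e2; ring.
  - by rewrite addrC subrK.
by exists (x - x'); rewrite e1 e2; congr (_, _, _); rewrite /= ?addr0 // addrC subrK.
Qed.

Lemma symm_act_rank1 B i c j :
  symm_act (B + rank1 i c) j = symm_act B j -> i = j \/ c = 0.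
Proof.
case: B i j => [[x y] z] [s|] [t|] /= [e1 e2].
- suff: c * (s - t) = 0 by case/mul0_eq => ->; [left | right].
  have -> : c * (s - t) = y + z * t - (y - c * s + (z + c) * t) by ring.
  by rewrite e2 subrr.
- by right; rewrite -[c](addKr z) e2 addNr.
- right; rewrite -[c](addKr (x + y * t)) -[X in _ + X]addrA.
  rewrite (_ : x + (y * t + c) = x + c + (y + 0) * t); last by ring.
  by rewrite e1 addNr.
- by left.
Qed.

(** The quadratic form of [rank1 i c] is [c] times the square of a linear form vanishing only at
    direction [i]. *)
Lemma dot_rank1 B i c j :
  dot j (symm_act (B + rank1 i c) j) = dot j (symm_act B j) -> i = j \/ c = 0.
Proof.
case: B i j => [[x y] z] [s|] [t|] /= e.
- have: c * (s - t) * (s - t) = 0.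
    rewrite -[RHS](subrr (x + y * t + t * (y + z * t))) -{1}e; ring.
  by case/mul0_eq => [->|/mul0_eq[->|->]]; [left | left | right].
- by right; rewrite -[c](addKr z) e addNr.
- right; rewrite -[c](addKr (x + y * t + t * (y + z * t))).
  by rewrite -{1}e; ring.
- by left.
Qed.

(* Three matrices (t^2, -t, 1) are independent by Vandermonde. *)
Lemma rank1_indep i j k a b c :
  rank1 i a + rank1 j b + rank1 k c = 0 -> [\/ i = j, i = k | a = 0].
Proof.
case: i j k => [s|] [t|] [u|] //= [e1 e2 e3]; try by [constructor 1 | constructor 2].
- suff: a * (s - t) * (s - u) = 0.
    by case/mul0_eq => [->|/mul0_eq[->|->]]; [constructor 2 | constructor 1 | constructor 3].
  have -> : a * (s - t) * (s - u) = (a * s ^+ 2 + b * t ^+ 2 + c * u ^+ 2)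
    + (- (a * s) - (b * t) - (c * u)) * (t + u) + (a + b + c) * (t * u) by ring.
  by rewrite e1 e2 e3; ring.
- suff: a * (s - t) = 0.
    by case/mul0_eq => ->; [constructor 1 | constructor 3].
  have -> : a * (s - t) = - (- (a * s) - b * t + 0) - (a + b + 0) * t by ring.
  by rewrite e2 e3; ring.
- suff: a * (s - u) = 0.
    by case/mul0_eq => ->; [constructor 2 | constructor 3].
  have -> : a * (s - u) = - (- (a * s) + 0 - c * u) - (a + 0 + c) * u by ring.
  by rewrite e2 e3; ring.
- by constructor 3; rewrite -e3 !addr0.
- constructor 3.
  have -> : a = (a + b * t ^+ 2 + c * u ^+ 2)
    + (0 - (b * t) - (c * u)) * (t + u) + (0 + b + c) * (t * u) by ring.
  by rewrite e1 e2 e3; ring.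
Qed.

Lemma rank1_0 i : rank1 i 0 = 0.
Proof. by case: i => [t|] //=; rewrite !mul0r oppr0. Qed.

Lemma rank1_inj i : injective (rank1 i).
Proof. by case: i => [t|] c d //= []. Qed.

Lemma incident_lin p q l m : incident p l -> incident q l ->
  incident p m -> incident q m -> p = q \/ l = m.
Proof.
case: l m => [A|[[i s]|[]]] [B|[[j t]|[]]]; case: p => [[k v]|k];
  case: q => [[h w]|h] //=; try by right.
- move=> /eqP<- /eqP<- /eqP/esym/symm_act_eq_rank1[c ->] /eqP/esym/symm_act_rank1.
  by case=> ->; [left | right; rewrite rank1_0 addr0].
- by move=> /eqP<- /eqP<- /andP[/eqP-> _] /andP[/eqP-> _]; left.
- by move=> /andP[/eqP-> _] /andP[/eqP-> _] /eqP<- /eqP<-; left.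
- by move=> /andP[/eqP<- /eqP<-] _ /andP[/eqP<- /eqP<-] _; right.
- by move=> /andP[/eqP<- /eqP<-] _ /andP[/eqP<- /eqP<-] _; right.
- by move=> _ /andP[/eqP<- /eqP<-] _ /andP[/eqP<- /eqP<-]; right.
- by move=> /eqP-> /eqP->; left.
- by move=> /eqP-> /eqP->; left.
- by move=> _ _ /eqP-> /eqP->; left.
Qed.

(** The equation is orthogonality for the symplectic form; it holds because every line is totally
    isotropic. *)
Lemma incident_orthogonal i v j w l :
  incident (inl (i, v)) l -> incident (inl (j, w)) l -> dot i w = dot j v.
Proof.
case: l => [[[x y] z]|[[k s]|[]]] //=.
  by move=> /eqP<- /eqP<-; case: i j => [s|] [t|] //=; ring.
by move=> /andP[/eqP-> /eqP e1] /andP[/eqP-> /eqP e2]; rewrite e1 e2.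
Qed.

Lemma symm_act_dot_eq A B i j : A <> B -> symm_act A i = symm_act B i ->
  dot j (symm_act A j) = dot j (symm_act B j) -> i = j.
Proof.
move=> AB /symm_act_eq_rank1[c eA]; rewrite eA in AB *.
by case/dot_rank1 => // c0; case: AB; rewrite c0 rank1_0 addr0.
Qed.

(** Each intersection makes the difference of two matrices a [rank1] term, and the three differences
    add up to 0. *)
Lemma symm_act_triangle A B C i j k : C <> A -> A <> B ->
  symm_act C i = symm_act A i -> symm_act A j = symm_act B j ->
  symm_act B k = symm_act C k -> i = j.
Proof.
move=> CA AB /symm_act_eq_rank1[c eC] /symm_act_eq_rank1[a eA] /symm_act_eq_rank1[b eB].
have e0 : rank1 i c + rank1 j a + rank1 k b = 0.
  have -> : rank1 i c = C - A by rewrite eC addrC addKr.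
  have -> : rank1 j a = A - B by rewrite eA addrC addKr.
  have -> : rank1 k b = B - C by rewrite eB addrC addKr.
  by rewrite [C - A + _]addrA subrK addrA subrK subrr.
have a0 : a <> 0 by move=> a0; apply: AB; rewrite eA a0 rank1_0 addr0.
have c0 : c <> 0 by move=> c0; apply: CA; rewrite eC c0 rank1_0 addr0.
(* If [i = k], swapping the first two terms puts [a] in front, and a second use of independence
   gives [j = k]. *)
case: (rank1_indep e0) => // ik; rewrite ik [rank1 k c + _]addrC in e0 *.
by case: (rank1_indep e0).
Qed.

(** Three matrices fall under [symm_act_triangle]. With two matrices and a line [(h, s)], both
    quadratic forms take the value [s] at [h], which is [symm_act_dot_eq]. With at most one matrix,
    comparing directions suffices. *)
Lemma incident_triangle p q r l m n : incident p l -> incident q l ->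
  incident q m -> incident r m -> incident r n -> incident p n ->
  l != m -> m != n -> n != l -> p = q.
Proof.
move=> pl ql qm rm rn pn /eqP lm /eqP mn /eqP nl; move: pl ql qm rm rn pn lm mn nl.
case: l => [A|l]; case: m => [B|m]; case: n => [C|n];
  case: p => [[i u]|i] //; case: q => [[j v]|j] //; case: r => [[k w]|k] //.
- move=> /eqP<- /eqP<- /eqP/esym Aj /eqP<- /eqP/esym Bk /eqP Ci AB BC CA.
  by rewrite (@symm_act_triangle A B C i j k) // => e; [apply: CA | apply: AB]; rewrite e.
- case: n => [[h s]|[]] //= /eqP<- /eqP<- /eqP/esym Aj /eqP<-.
  move=> /andP[/eqP-> e] /andP[/eqP-> /eqP]; rewrite -(eqP e) => Ah AB _ _.
  by rewrite (@symm_act_dot_eq A B j h) // => eAB; apply: AB; rewrite eAB.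
- case: m => [[h s]|[]] //= /eqP<- /eqP<- /andP[/eqP-> e] + /eqP Ck /eqP Ai.
  rewrite -{}Ck => /andP[/eqP-> /eqP]; rewrite -(eqP e) => Ah _ _ CA.
  by rewrite (@symm_act_dot_eq C A i h) // => eCA; apply: CA; rewrite eCA.
all: try (case: l => [[? ?]|[]]); try (case: m => [[? ?]|[]]);
  try (case: n => [[? ?]|[]]); rewrite /incident //.
all: intros.
all: repeat match goal with
  | H : is_true (_ && _) |- _ => case/andP: H => ? ?
  | H : is_true (_ == _) |- _ => move/eqP in H; subst end.
all: try congruence.
have BC : B <> C by move=> eBC; apply: mn; rewrite eBC.
match goal with E : dot _ _ = _ |- _ => by rewrite -(symm_act_dot_eq BC rm E) rm end.
Qed.

(** The lines on a point and the points on a line each form a projective line, counted here by a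
    bijection with [dir]. *)
Lemma card_parametrized (T : finType) (f : dir -> T) (S : pred T) :
  injective f -> (forall c, S (f c)) -> (forall x, S x -> exists c, x = f c) ->
  #|[set x | S x]| = #|F|.+1.
Proof.
move=> f_inj fS Sf; rewrite -card_option -cardsT -(card_imset _ f_inj).
apply: eq_card => x; rewrite !inE; apply/idP/imsetP => [/Sf[c ->]|[c _ ->]] //.
by exists c; rewrite ?inE.
Qed.

Lemma card_lines_on p : #|[set l : line | incident p l]| = #|F|.+1.
Proof.
case: p => [[i w]|i].
  (* One particular symmetric matrix sending [v0] to [w]; the others differ from it by
     [rank1 i c]. *)
  pose A0 : symmx := if i is Some t then (w.1 - w.2 * t, w.2, 0) else (0, w.1, w.2).
  have A0i : symm_act A0 i = w.
    by case: i w @A0 => [t|] [w1 w2] //=; rewrite mul0r addr0 subrK.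
  pose f (c : dir) : line :=
    if c is Some c then inl (A0 + rank1 i c) else inr (inl (i, dot i w)).
  apply: (@card_parametrized _ f) => [[c|] [d|] // | [c|] | [A|[[j s]|[]]]] //=.
  - move=> e.
    have e' : A0 + rank1 i c = A0 + rank1 i d := inl_inj e.
    by rewrite (rank1_inj (addrI A0 e')).
  - apply/eqP; rewrite -[RHS]A0i; case: (A0) => [[x y] z].
    by case: (i) => [t|] /=; congr (_, _); ring.
  - by rewrite !eqxx.
  - move=> /eqP Ai; have [c ->] : exists c, A = A0 + rank1 i c.
      by apply: symm_act_eq_rank1; rewrite Ai.
    by exists (Some c).
  - by move=> /andP[/eqP<- /eqP<-]; exists None.
pose f (c : dir) : line := inr (if c is Some s then inl (i, s) else inr tt).
apply: (@card_parametrized _ f) => [[c|] [d|] //= [->] | [c|] | [A|[[j s]|[]]]] //=.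
  by move=> /eqP<-; exists (Some s).
by exists None.
Qed.

Lemma card_points_on l : #|[set p : point | incident p l]| = #|F|.+1.
Proof.
case: l => [A|[[i s]|[]]].
- pose f (i : dir) : point := inl (i, symm_act A i).
  apply: (@card_parametrized _ f) => [c d [] | c | [[i w]|i]] //=.
  by move=> /eqP<-; exists i.
- pose f (c : dir) : point := if c is Some c then
      inl (i, if i is Some t then (s - t * c, c) else (c, s))
    else inr i.
  apply: (@card_parametrized _ f) => [[c|] [d|] //= | [c|] | [[j w]|j]] //=.
  + by case: (i) => [t|] [] => [_ ->|->].
  + by rewrite eqxx; case: (i) => [t|] //=; rewrite subrK.
  + move=> /andP[/eqP-> /eqP e]; rewrite /f -{}e; case: (i) w => [t|] [w1 w2] /=.
      by exists (Some w2); rewrite addrK.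
    by exists (Some w1).
  + by move=> /eqP->; exists None.
- pose f (i : dir) : point := inr i.
  by apply: (@card_parametrized _ f) => [c d [] | c | [[i w]|i]] //= _; exists i.
Qed.

Lemma card_dir : #|dir| = #|F|.+1.
Proof. exact: card_option. Qed.

Lemma card_point : #|point| = (#|F|.+1 * (#|F| * #|F|) + #|F|.+1)%N.
Proof.
rewrite [LHS]card_sum card_dir; congr (_ + _)%N.
by rewrite [LHS]card_prod card_dir [X in (_ * X)%N]card_prod.
Qed.

Lemma card_line : #|line| = (#|F| * #|F| * #|F| + (#|F|.+1 * #|F| + 1))%N.
Proof.
rewrite [LHS]card_sum; congr (_ + _)%N.
  by rewrite [LHS]card_prod [X in (X * _)%N]card_prod.
by rewrite [LHS]card_sum card_unit [X in (X + _)%N]card_prod card_dir.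
Qed.

End SymplecticQuadrangle.

(** * The deleted lines and their matchings *)

Definition F13_dir : finType := dir 'F_13.

(** An explicit list, so that [all] over it can be evaluated. *)
Definition scalars : seq 'F_13 := [seq n%:R | n <- iota 0 13].
Definition directions : seq F13_dir := None :: map Some scalars.

Lemma mem_scalars t : t \in scalars.
Proof.
apply/mapP; exists (val t); last by rewrite natr_Zp.
by rewrite mem_iota /= (ltn_ord t).
Qed.

Lemma mem_directions i : i \in directions.
Proof. by case: i => [t|] //; rewrite inE map_f // mem_scalars. Qed.

(* The deleted lines are the symmetric matrices ((x, y), (y, z)) with
   (x, z) = (class_x k, class_z k) for some k < 4 and y arbitrary.  They are
   pairwise disjoint because (x - x') (z - z') is a nonsquare for any two of the
   four pairs. *)
Definition class_x (k : nat) : 'F_13 := (nth 0 [:: 0; 5; 6; 1] k)%N%:R.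
Definition class_z (k : nat) : 'F_13 := (nth 0 [:: 0; 4; 10; 6] k)%N%:R.

(* Found by simulated annealing.  The entry 13 stands for the direction [None]. *)
Definition matching_table : seq (seq nat) :=
  [:: [:: 10; 5; 3; 2; 12; 1; 9; 11; 13; 6; 0; 7; 4; 8];
      [:: 4; 11; 10; 9; 0; 12; 13; 8; 7; 3; 2; 1; 5; 6];
      [:: 2; 6; 0; 7; 5; 4; 1; 3; 11; 13; 12; 8; 10; 9];
      [:: 12; 4; 7; 6; 1; 9; 3; 2; 10; 5; 8; 13; 0; 11]]%N.

Definition matching (k : nat) (i : F13_dir) : F13_dir :=
  let n := nth 0 (nth [::] matching_table k) (if i is Some t then val t else 13) in
  if n == 13 then None else Some n%:R.

Lemma matching_check : all (fun k => all (fun i =>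
  (matching k (matching k i) == i) && (matching k i != i)) directions) (iota 0 4).
Proof. by vm_compute. Qed.

Lemma matchingK (k : 'I_4) : involutive (matching k).
Proof.
move=> i; have /allP/(_ (val k))/(_ _)/allP/(_ i) := matching_check.
by rewrite mem_iota ltn_ord mem_directions => /(_ _ _)/andP[] // /eqP.
Qed.

Lemma matching_neq (k : 'I_4) i : matching k i != i.
Proof.
have /allP/(_ (val k))/(_ _)/allP/(_ i) := matching_check.
by rewrite mem_iota ltn_ord mem_directions => /(_ _ _)/andP[].
Qed.

(** The value at [w = 0] is arbitrary. *)
Definition perp (w : 'F_13 * 'F_13) : F13_dir :=
  if w.2 == 0 then None else Some (- w.1 / w.2).

Lemma dot_eq0 i w : dot i w = 0 -> w <> 0 -> i = perp w.
Proof.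
case: w => w1 w2; rewrite /perp /=; case: eqP => [->|/eqP w2_neq0].
  by case: i => [t|] //=; rewrite mulr0 addr0 => ->.
case: i => [t|] /=; last by move/eqP: w2_neq0.
by move=> /eqP; rewrite addr_eq0 => /eqP-> _; rewrite opprK mulfK.
Qed.

(** Translating [y] permutes the deleted lines of a class, so only the difference of the two [y] has
    to be enumerated. *)
Definition class_diff (k m : nat) (y : 'F_13) : symmx 'F_13 :=
  (class_x m - class_x k, y, class_z m - class_z k).

(* For the difference B of two deleted lines, [perp (B v_j)] is the only direction
   whose point on the first line is collinear with the point of direction j on the
   second one. *)
Lemma matching_diff_check : all (fun k => all (fun m => all (fun y => all (fun j =>
    (k == m) && (y == 0) || let w := symm_act (class_diff k m y) j in
      (w != 0) && (dot (matching k (perp w))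
        (symm_act (class_diff k m y) (matching m j)) != 0))
  directions) scalars) (iota 0 4)) (iota 0 4).
Proof. by lazy. Qed.

(** * From matchings of directions to an involution on points *)

Notation point13 := (point 'F_13).
Notation line13 := (line 'F_13).

Definition class_mx (k : 'I_4) (y : 'F_13) : symmx 'F_13 := (class_x k, y, class_z k).
Definition deleted : {set line13} :=
  [set inl (class_mx u.1 u.2) | u : 'I_4 * 'F_13].
Definition spread_point (k : 'I_4) (y : 'F_13) (i : F13_dir) : point13 :=
  inl (i, symm_act (class_mx k y) i).

Lemma symm_actB (F : finFieldType) (A B : F * F * F) i :
  symm_act (A - B) i = symm_act A i - symm_act B i.
Proof.
by case: A B i => [[x y] z] [[x' y'] z'] [t|] //=; congr (_, _) => /=; ring.
Qed.

Lemma dot_symm_actC (F : finFieldType) (A : F * F * F) i j :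
  dot i (symm_act A j) = dot j (symm_act A i).
Proof. by case: A i j => [[x y] z] [s|] [t|] //=; ring. Qed.

Lemma dotB (F : finFieldType) (i : dir F) v w : dot i (v - w) = dot i v - dot i w.
Proof. by case: i v w => [t|] [v1 v2] [w1 w2] //=; ring. Qed.

Lemma class_mxB k m y y' : class_mx m y' - class_mx k y = class_diff k m (y' - y).
Proof. by []. Qed.

Lemma matching_diff (k m : 'I_4) y y' j : (k, y) != (m, y') ->
  let w := symm_act (class_mx m y' - class_mx k y) j in
  w <> 0 /\ dot (matching k (perp w))
    (symm_act (class_mx m y' - class_mx k y) (matching m j)) <> 0.
Proof.
move=> neq; rewrite class_mxB.
have /allP/(_ (val k))/(_ _)/allP/(_ (val m)) := matching_diff_check.
rewrite !mem_iota !ltn_ord => /(_ _ _)/allP/(_ (y' - y)).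
rewrite mem_scalars => /(_ _ _ _)/allP/(_ j).
rewrite mem_directions => /(_ _ _ _ _)/orP[] // [].
  by rewrite subr_eq0 => /andP[/eqP/val_inj km /eqP yy]; rewrite km yy eqxx in neq.
by move=> /andP[/eqP ? /eqP ?].
Qed.

(** At a common point of direction [i], the difference of the matrices would kill the vector of [i],
    against the first half of [matching_diff]. *)
Lemma deleted_disjoint p k m y y' : incident p (inl (class_mx k y)) ->
  incident p (inl (class_mx m y')) -> (k, y) = (m, y').
Proof.
case: p => [[i w]|i] //= /eqP ek /eqP em; apply/eqP; apply: contraT => neq.
have [w_neq0 _] := matching_diff i neq; case: w_neq0; apply/eqP.
by rewrite symm_actB subr_eq0; apply/eqP; exact: etrans em (esym ek).
Qed.

(** By [deleted_disjoint] at most one [u] qualifies, so [pick] makes no real choice. The points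
    [inr _] are on no deleted line. *)
Definition mate (p : point13) : point13 :=
  if p is inl (i, _) then
    if [pick u | incident p (inl (class_mx u.1 u.2))] is Some (k, y)
    then spread_point k y (matching k i) else p
  else p.

Arguments mate : simpl never.

Lemma incident_spread_point k y i : incident (spread_point k y i) (inl (class_mx k y)).
Proof. exact: eqxx. Qed.

Lemma mate_spread_point k y i :
  mate (spread_point k y i) = spread_point k y (matching k i).
Proof.
rewrite /mate {1}/spread_point; case: pickP => [[m y'] /= e | /(_ (k, y)) /=].
  by case: (deleted_disjoint (incident_spread_point k y i) e) => -> ->.
by rewrite eqxx.
Qed.

Variant mate_spec p : Prop :=
  | MateSpread k y i of p = spread_point k y i
  | MateFixed of mate p = p & forall l, l \in deleted -> ~~ incident p l.

Lemma mateP p : mate_spec p.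
Proof.
have [[k y] /= e | none] := pickP (fun u => incident p (inl (class_mx u.1 u.2))).
  case: p e => [[i w]|i] //= /eqP e.
  by apply: (@MateSpread _ k y i); rewrite -e.
apply: MateFixed => [|l /imsetP[u _ ->]]; last by rewrite none.
case: p none => [[i w]|i] none //; rewrite /mate.
by case: pickP => // u; have := none u => /= ->.
Qed.

Lemma spread_point_inj k y : injective (spread_point k y).
Proof. by move=> i j []. Qed.

Lemma mateK : involutive mate.
Proof.
move=> p; case: (mateP p) => [k y i ->|e _]; last by rewrite !e.
by rewrite !mate_spread_point matchingK.
Qed.

Lemma mate_spread_point_neq k y i : mate (spread_point k y i) != spread_point k y i.
Proof.
by rewrite mate_spread_point (inj_eq (@spread_point_inj k y)) matching_neq.
Qed.

Lemma card_deleted p : #|[set l in deleted | incident p l]| = (mate p != p).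
Proof.
case: (mateP p) => [k y i ->|e none].
  rewrite mate_spread_point_neq; apply/eqP/cards1P; exists (inl (class_mx k y)).
  apply/setP => l; rewrite !inE; apply/andP/eqP => [[/imsetP[[m y'] _ ->] e]|->].
    by case: (deleted_disjoint (incident_spread_point k y i) e) => -> ->.
  by split; [apply/imsetP; exists (k, y) | exact: incident_spread_point].
rewrite e eqxx; apply/eqP; rewrite cards_eq0; apply/eqP/setP => l.
by rewrite !inE; apply/negP => /andP[/none/negP].
Qed.

Lemma mate_line p l : l \in deleted -> incident p l -> incident (mate p) l.
Proof.
case: (mateP p) => [k y i -> /imsetP[[m y'] _ ->] e|-> //].
case: (deleted_disjoint (incident_spread_point k y i) e) => -> ->.
by rewrite mate_spread_point incident_spread_point.
Qed.

(** Two distinct points of one deleted line share no other line. For two deleted lines whose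
    matrices differ by B, collinearity of [p] and [q] forces [i] to be [perp (B v_j)], and then
    collinearity of their mates contradicts the second half of [matching_diff]. *)
Lemma mate_quad p q l m : mate p != p -> mate q != q ->
  l \notin deleted -> m \notin deleted -> incident p l -> incident q l ->
  incident (mate p) m -> incident (mate q) m -> p = q.
Proof.
case: (mateP p) => [k y i ->|-> _]; last by rewrite eqxx.
case: (mateP q) => [k' y' j ->|-> _ _]; last by rewrite eqxx.
move=> _ _ lD _ pl ql; rewrite !mate_spread_point => pm qm.
have [[ek ey]|/matching_diff] := eqVneq (k, y) (k', y').
  rewrite -{}ek -{}ey in ql *; have := incident_lin pl ql
    (incident_spread_point k y i) (incident_spread_point k y j).
  by case=> // el; case/imsetP: lD; exists (k, y).
have diff_eq0 i1 j1 n : incident (spread_point k y i1) n ->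
    incident (spread_point k' y' j1) n ->
    dot i1 (symm_act (class_mx k' y' - class_mx k y) j1) = 0.
  move=> /incident_orthogonal on /on e.
  by rewrite symm_actB dotB e [X in _ - X]dot_symm_actC subrr.
move=> /(_ j)[w_neq0]; rewrite -(dot_eq0 (diff_eq0 _ _ _ pl ql) w_neq0).
by case; exact: diff_eq0 pm qm.
Qed.

Lemma card_deleted_set : #|deleted| = 52.
Proof.
rewrite card_imset ?card_prod ?card_ord //.
move=> [k y] [m y'] e; apply: (deleted_disjoint (incident_spread_point k y None)).
by rewrite -[inl (class_mx m y')]e; exact: incident_spread_point.
Qed.

(** * The graph with 4708 vertices *)

Definition graph_14_7 : sgraph := rewired_graph (@incident 'F_13) deleted mateK.

Lemma card_graph_14_7 : #|graph_14_7| = 4708.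
Proof.
rewrite card_rewired_graph card_deleted_set.
by rewrite card_point card_line card_ord.
Qed.

Lemma ideal_not_deleted l : inr l \notin deleted.
Proof. by apply/imsetP => - []. Qed.

(** One matching edge is closed up by six incidences through the points [inr i] and [inr j] of the
    line [inr (inr tt)]. *)
Lemma graph_14_7_7cycle : exists c : seq graph_14_7, graph_cycle c /\ size c = 7.
Proof.
pose ideal l : graph_14_7 := inr (exist _ (inr l) (ideal_not_deleted l)).
have [i [j [v [w [ij matevw vi wj]]]]] : exists i j v w, [/\ i != j,
    mate (inl (i, v)) = inl (j, w), dot i v = 0 & dot j w = 0].
  (* [class_mx ord0 0] is the zero matrix, so the two ends lie on the lines [(i, 0)] and
     [(j, 0)]. *)
  exists None, (matching 0 None), (symm_act (class_mx ord0 0) None),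
    (symm_act (class_mx ord0 0) (matching 0 None)).
  split; rewrite ?[None == _]eq_sym ?matching_neq //; first exact: mate_spread_point.
  by apply/eqP; vm_compute.
exists [:: inl (inl (i, v)); inl (inl (j, w)); ideal (inl (j, 0)); inl (inr j);
           ideal (inr tt); inl (inr i); ideal (inl (i, 0))].
split=> //; split=> //; apply/andP; split.
  rewrite /cycle /path /rcons /adj /= matevw vi wj !eqxx /= andbT.
  by rewrite (inj_eq inl_inj) xpair_eqE (negPf ij).
(* The kind and direction of a vertex already separate the seven vertices, since [i != j]. *)
pose key (x : graph_14_7) : nat * F13_dir := match x with
  | inl (inl (k, _)) => (0%N, k)
  | inl (inr k) => (1%N, k)
  | inr l => if val l is inr (inl (k, _)) then (2%N, k) else (3%N, None)
  end.
apply: (@map_uniq _ _ key); rewrite /map /key /=.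
by rewrite !inE !xpair_eqE /= [j == i]eq_sym (negPf ij).
Qed.

Lemma kg_graph_graph_14_7 : kg_graph 14 7 graph_14_7.
Proof.
split.
  apply: rewired_graph_regular; first exact: card_deleted.
    by move=> p; rewrite card_lines_on card_ord.
  by move=> l; rewrite card_points_on card_ord.
split; first exact: graph_14_7_7cycle.
apply: rewired_graph_girth.
- exact: incident_lin.
- exact: incident_triangle.
- exact: card_deleted.
- exact: mate_line.
- exact: mate_quad.
Qed.

(* Existence of the minimum order *)
Local Close Scope ring_scope.

(** Descent on the number of vertices; excluded middle decides whether a smaller (k,g)-graph
    exists. *)
Lemma min_order_exists k g (G : sgraph) : kg_graph k g G ->
  exists n, is_min_order k g n /\ n <= #|G|.
Proof.
have [n leGn] := ubnP #|G|; elim: n => // n IHn in G leGn *.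
move=> kgG; case: (classic (exists H, kg_graph k g H /\ #|H| < #|G|)).
  case=> H [kgH ltHG]; have [|m [minm lemH]] := IHn H _ kgH.
    exact: leq_trans ltHG _.
  by exists m; split=> //; apply: leq_trans lemH (ltnW ltHG).
move=> none; exists #|G|; split=> //; split; first by exists G.
move=> H kgH; rewrite leqNgt; apply/negP => ltHG; apply: none.
by exists H.
Qed.

Theorem mainTheorem11 :
  exists n : nat, is_min_order 14 7 n /\ n <= 4716.
Proof.
have [n [minn len]] := min_order_exists kg_graph_graph_14_7.
by exists n; split=> //; rewrite card_graph_14_7 in len; apply: leq_trans len _.
Qed.
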